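(* Let $f:\mathbb{R}\to\mathbb{R}$ be a function with the Baire property, let $T\subset\mathbb{R}$ be a set of second category, and let $g:\mathbb{R}^2\to\mathbb{R}$ be a function such that for each $t\in T$ the function $g(\cdot,t)$ is equal to $f(\cdot+t)$ on a residual subset of $\mathbb{R}$. If there exists a second countable topology $\mathcal{T}$ on the set $T$ such that for a residual set of $s\in\mathbb{R}$ the function $g(s,\cdot)|_T$ is $\mathcal{T}$-continuous, then $f$ is equal on a residual set to a continuous function $h:\mathbb{R}\to\mathbb{R}$, and for a residual set of $s\in\mathbb{R}$, $g(s,\cdot)|_T=h(s+\cdot)|_T$.
   Context: A set is of first category if it is a countable union of nowhere dense sets, and of second category otherwise; a subset of $\mathbb{R}$ is residual if its complement is of first category. A function has the Baire property if preimages of open sets have the Baire property. The topology $\mathcal{T}$ on $T$ is an arbitrary second countable topology, not assumed related to the usual one; continuity of $h$ is in the usual topology. *)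

(* Defs.v *)
From HB Require Import structures.
From mathcomp Require Export all_boot all_order all_algebra.
From mathcomp Require Export all_classical all_reals all_analysis.
Export numFieldNormedType.Exports.

Set Implicit Arguments.
Unset Strict Implicit.
Unset Printing Implicit Defensive.

Local Open Scope classical_set_scope.

Definition nowhere_dense (X : topologicalType) (A : set X) : Prop :=
  (closure A)° = set0.

(* Indexing by nat covers finite unions too, since set0 is nowhere dense. *)
Definition first_category (X : topologicalType) (A : set X) : Prop :=
  exists2 F : nat -> set X,
    (forall n, nowhere_dense (F n)) & A = \bigcup_n F n.

Definition second_category (X : topologicalType) (A : set X) : Prop :=
  ~ first_category A.

Definition residual (X : topologicalType) (A : set X) : Prop :=
  first_category (~` A).

(* `+` is the symmetric difference of sets. *)
Definition baire_property_set (X : topologicalType) (A : set X) : Prop :=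
  exists2 U : set X, open U & first_category (A `+` U).

Definition baire_property (X Y : topologicalType) (f : X -> Y) : Prop :=
  forall V : set Y, open V -> baire_property_set (f @^-1` V).

(* Main.v *)
(* Let [f] be continuous on the residual set [E], let [F] be a countable base of
   the topology on [T], and let [D] be a countable subset of [T] with [A `&` D]
   dense in [A], in the usual topology, for every [A] in [F].  For all [s] in a
   residual set [S'], [g (s, t) = f (s + t)] and [E (s + t)] hold at every [t] in
   [D], and [g (s, _)] is continuous on [T].  Removing from [T] the sets
   [A `\` (closure A)°], which are nowhere dense, leaves a set of second
   category, so that every real [x] is [s + t] with [s] in [S'] and [t] in [T] not
   removed.  A small basic neighborhood [A] of [t] is then dense around [t], and
   [g (s, _)] is almost constant on [A], so [f] is almost constant on a dense
   subset of [E] around [x], hence on [E] around [x] because [f] is continuous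
   on [E].  So [f] on [E] has a limit at every point of the line, and these
   limits form the continuous extension [h]. *)
Require Import Defs.

Set Implicit Arguments.
Unset Strict Implicit.
Unset Printing Implicit Defensive.

Import Order.TTheory GRing.Theory Num.Theory.

Local Open Scope classical_set_scope.
Local Open Scope ring_scope.

(** * Nowhere dense, first category and residual sets *)

Lemma nowhere_denseS (X : topologicalType) (A B : set X) :
  A `<=` B -> nowhere_dense B -> nowhere_dense A.
Proof.
move=> AB B0; rewrite /nowhere_dense -subset0 -B0.
by apply: interiorS; exact: closureS.
Qed.

Lemma nowhere_dense0 (X : topologicalType) : nowhere_dense (@set0 X).
Proof. by rewrite /nowhere_dense closure0 interior0. Qed.

(** An interior point of the closure of the difference would lie in [(closure A)°], an open set that
    the difference misses. *)
Lemma nowhere_dense_setDclosure (X : topologicalType) (A : set X) :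
  nowhere_dense (A `\` (closure A)°).
Proof.
rewrite /nowhere_dense -subset0 => x xA.
have sub : closure (A `\` (closure A)°) `<=` closure A.
  by apply: closureS; exact: subDsetl.
have xA' : (closure A)° x by exact: (interiorS sub).
have [y [[_ yA] yA']] := interior_subset xA _
  (open_nbhs_nbhs (conj (open_interior (closure A)) xA')).
exact: yA.
Qed.

Lemma nowhere_dense_preimage (X Y : topologicalType) (phi : X -> Y)
    (psi : Y -> X) (A : set Y) :
  continuous phi -> continuous psi -> cancel phi psi -> cancel psi phi ->
  nowhere_dense A -> nowhere_dense (phi @^-1` A).
Proof.
move=> cphi cpsi phiK psiK A0; rewrite /nowhere_dense -subset0 => x xA.
have sub : closure (phi @^-1` A) `<=` phi @^-1` closure A.
  have /continuous_closedP/(_ _ (@closed_closure _ A))/closure_id -> := cphi.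
  by apply: closureS; apply: preimage_subset; exact: subset_closure.
suff : (closure A)° (phi x) by rewrite A0.
pose O := (closure (phi @^-1` A))°.
have Oopen : open (psi @^-1` O).
  by have /continuousP := cpsi; apply; exact: open_interior.
apply: (@filterS _ _ _ (psi @^-1` O)).
  by move=> y /= /interior_subset/sub /=; rewrite psiK.
by apply: open_nbhs_nbhs; split => //=; rewrite phiK.
Qed.

Lemma first_categoryS (X : topologicalType) (A B : set X) :
  A `<=` B -> first_category B -> first_category A.
Proof.
move=> AB [F F0 BE]; exists (fun n => A `&` F n).
  by move=> n; apply: nowhere_denseS (F0 n) => x [].
by rewrite -setI_bigcupr -BE; apply/esym/setIidPl.
Qed.

Lemma nowhere_dense_first_category (X : topologicalType) (A : set X) :
  nowhere_dense A -> first_category A.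
Proof. by move=> A0; exists (fun=> A) => //; rewrite bigcup_const. Qed.

Lemma first_category_bigcup (X : topologicalType) (I : Type) (D : set I)
    (F : I -> set X) :
  countable D -> (forall i, D i -> first_category (F i)) ->
  first_category (\bigcup_(i in D) F i).
Proof.
move=> /countable_injP[e einj] F1.
have /choice[G GP] : forall i, exists G : nat -> set X,
    D i -> (forall n, nowhere_dense (G n)) /\ F i = \bigcup_n G n.
  move=> i; have [Di|nDi] := pselect (D i); last by exists (fun=> set0).
  by have [G G0 GE] := F1 _ Di; exists G.
(* As [e] is injective on [D], this union has at most one term: it decodes [p.1] without an inverse
   of [e], and is empty when [p.1] codes no index. *)
pose H (p : nat * nat) := \bigcup_(i in [set i | D i /\ e i = p.1]) G i p.2.
exists (fun k => if unpickle k is Some p then H p else set0).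
  move=> k; case: unpickle => [[m n]|]; last exact: nowhere_dense0.
  have [[i [Di /= eim]]|noi] := pselect (exists i, D i /\ e i = m).
    apply: nowhere_denseS ((GP i Di).1 n) => x [j [/= Dj ejm] Gj].
    by rewrite (_ : i = j)//; apply: einj; rewrite ?inE// eim ejm.
  apply: nowhere_denseS (@nowhere_dense0 X) => x [j Dj _].
  by apply: noi; exists j.
apply/seteqP; split=> x.
  move=> [i Di]; rewrite (GP i Di).2 => -[n _ Gx].
  by exists (pickle (e i, n)) => //; rewrite pickleK; exists i.
move=> [k _]; case: unpickle => [[m n]|//] [i [Di _]] Gx.
by exists i => //; rewrite (GP i Di).2; exists n.
Qed.

Lemma first_category_preimage (X Y : topologicalType) (phi : X -> Y)
    (psi : Y -> X) (A : set Y) :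
  continuous phi -> continuous psi -> cancel phi psi -> cancel psi phi ->
  first_category A -> first_category (phi @^-1` A).
Proof.
move=> cphi cpsi phiK psiK [F F0 ->]; exists (fun n => phi @^-1` F n) => //.
move=> n; exact: (@nowhere_dense_preimage _ _ _ psi).
Qed.

Lemma first_categoryU (X : topologicalType) (A B : set X) :
  first_category A -> first_category B -> first_category (A `|` B).
Proof.
move=> A1 B1; rewrite (_ : A `|` B = \bigcup_b (if b then A else B)).
  by apply: first_category_bigcup => // -[].
apply/seteqP; split=> x; first by move=> [?|?]; [exists true|exists false].
by move=> [[] _ ?]; [left|right].
Qed.

Lemma residualS (X : topologicalType) (A B : set X) :
  A `<=` B -> residual A -> residual B.
Proof. by move=> AB; apply: first_categoryS; exact: subsetC. Qed.

Lemma residualI (X : topologicalType) (A B : set X) :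
  residual A -> residual B -> residual (A `&` B).
Proof. by move=> A1 B1; rewrite /residual setCI; exact: first_categoryU. Qed.

Lemma residual_bigcap (X : topologicalType) (I : Type) (D : set I)
    (F : I -> set X) :
  countable D -> (forall i, D i -> residual (F i)) ->
  residual (\bigcap_(i in D) F i).
Proof.
by move=> cD F1; rewrite /residual setC_bigcap; exact: first_category_bigcup.
Qed.

(** * Countable bases, the Baire property and extension by limits *)

Lemma second_countable_realType (R : realType) : @second_countable R.
Proof.
exists (range (fun p : rat * rat => `]ratr p.1, ratr p.2[%classic : set R)).
  by apply: sub_countable (card_image_le _ _) _.
split=> [_ [p _ <-]|x U /nbhs_ballP[e /= e0 xeU]]; first exact: interval_open.
have /rat_in_itvoo[p pP] : x - e < x by rewrite ltrBlDr ltrDl.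
have /rat_in_itvoo[q qP] : x < x + e by rewrite ltrDl.
move: pP qP; rewrite !in_itv /= => /andP[p1 p2] /andP[q1 q2].
exists `]ratr p, ratr q[%classic.
  by split; [exists (p, q)|rewrite /= in_itv /= p2 q1].
move=> y /=; rewrite in_itv /= => /andP[py yq].
apply: xeU; rewrite /ball /= ltr_distlC.
by rewrite (lt_trans p1 py) (lt_trans yq q2).
Qed.

Lemma countable_dense_subset (X : topologicalType) (A : set X) :
  @second_countable X ->
  exists D, [/\ countable D, D `<=` A & A `<=` closure D].
Proof.
move=> [B cB [_ Bnbhs]].
(* One point of [A] is picked in each basic open set that meets [A]. *)
have /choice[d dP] : forall b : set X, exists D : set X,
    [/\ countable D, D `<=` A & b `&` A !=set0 -> b `&` D !=set0].
  move=> b; have [[x [bx Ax]]|nb] := pselect (b `&` A !=set0).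
    exists [set x]; split => //; first by move=> _ ->.
    by move=> _; exists x.
  by exists set0; split.
exists (\bigcup_(b in B) d b); split.
- by apply: bigcup_countable => // b _; have [] := dP b.
- by move=> x [b _]; have [_ + _] := dP b; apply.
move=> x Ax U /Bnbhs[b [/= Bb bx] bU].
have [_ _ []] := dP b; first by exists x.
move=> y [bY dy]; exists y; split; last exact: bU.
by exists b.
Qed.

(** Each basic open set has a preimage equal to an open set up to a set of first category; [E]
    avoids these countably many errors, so the traces on [E] of the preimages are relatively
    open. *)
Lemma baire_property_continuous (X Y : topologicalType) (f : X -> Y) :
  @second_countable Y -> baire_property f ->
  exists2 E, residual E & {within E, continuous f}.
Proof.
move=> [B cB [Bopen Bnbhs]] fB.
have /choice[U UP] : forall b : set Y, exists U : set X,
    B b -> open U /\ first_category ((f @^-1` b) `+` U).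
  move=> b; have [Bb|nBb] := pselect (B b); last by exists set0.
  by have [U] := fB _ (Bopen _ Bb); exists U.
pose E := ~` \bigcup_(b in B) ((f @^-1` b) `+` U b).
have EU b y : B b -> E y -> b (f y) <-> U b y.
  move=> Bb Ey; split=> [bfy|Uy]; apply: contrapT => nH; apply: Ey.
    by exists b => //; left.
  by exists b => //; right.
exists E.
  by rewrite /residual setCK; apply: first_category_bigcup => // b /UP[].
apply/subspace_continuousP => x Ex V /Bnbhs[b [/= Bb bfx] bV].
change (\forall y \near x, E y -> V (f y)).
have : nbhs x (U b).
  by apply: open_nbhs_nbhs; split; [have [] := UP b Bb|exact/EU].
by apply: filterS => y Uy Ey; apply: bV; exact/(EU b).
Qed.

Lemma dense_continuous_extension (R : realType) (X : topologicalType)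
    (E : set X) (f : X -> R) :
  (forall x, closure E x) -> (forall x : X, cvg (f @ within E (nbhs x))) ->
  exists2 h : X -> R, continuous h & forall x, E x -> h x = f x.
Proof.
move=> Edense fcvg; pose h (x : X) := lim (f @ within E (nbhs x)).
have hP x : forall e, 0 < e ->
    \forall y \near x, E y -> `|h x - f y| < e.
  by move=> e e0; have /cvgrPdist_lt/(_ e e0) := fcvg x.
(* Both limits are compared with [f z] at a common point [z] of [E] near [y]. *)
have hclose x y e : 0 < e -> (\forall z \near y, E z -> `|h x - f z| < e) ->
    `|h x - h y| < e + e.
  move=> e0 xyz; have [z [Ez [xz yz]]] := Edense y _ (filterI xyz (hP y e e0)).
  have -> : h x - h y = (h x - f z) - (h y - f z) by rewrite opprB addrA subrK.
  by rewrite (le_lt_trans (ler_normB _ _))// ltrD ?xz ?yz.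
exists h => x.
  apply/cvgrPdist_lt => e e0; have e20 : 0 < e / 2 by rewrite divr_gt0.
  have /nbhs_interior := hP x _ e20.
  by apply: filterS => y xy; rewrite (splitr e); exact: hclose.
move=> Ex; apply/eqP; rewrite -subr_eq0 -normr_le0; apply/ler_addgt0Pr => e e0.
by rewrite add0r ltW// (nbhs_singleton (hP x e e0)).
Qed.

(** * Translates on the line and the main argument *)

Section translates.
Variable R : realType.
Implicit Types (f h : R -> R) (g : R * R -> R) (E S T D A : set R).

Lemma first_category_reflect A x :
  first_category A -> first_category [set t | A (x - t)].
Proof.
have c : continuous (fun t : R => x - t).
  by move=> t; apply: cvgB; [exact: cvg_cst|exact: cvg_id].
by apply: (first_category_preimage c c) => t; rewrite subKr.
Qed.

Lemma residual_shift E t : residual E -> residual [set s | E (s + t)].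
Proof.
have c u : continuous (fun s : R => s + u).
  by move=> s; apply: cvgD; [exact: cvg_id|exact: cvg_cst].
apply: (first_category_preimage (c t) (c (- t))) => s; first exact: addrK.
exact: subrK.
Qed.

Lemma nbhs_addl (s t : R) (P : set R) :
  nbhs (s + t) P -> nbhs t [set u | P (s + u)].
Proof. exact: (cvgD (cvg_cst s) cvg_id). Qed.

(* Only a countable base [F] of the topology on [T] enters the argument, with its
   elements viewed as sets of reals. *)
Lemma continuous_extension_of_sections f T g (F : set (set R)) :
  baire_property f -> second_category T ->
  (forall t, T t -> residual [set s | g (s, t) = f (s + t)]) ->
  countable F -> (forall A, F A -> A `<=` T) ->
  residual [set s | forall t, T t -> forall e, 0 < e ->
    exists A, [/\ F A, A t & forall u, A u -> `|g (s, t) - g (s, u)| < e]] ->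
  exists h, [/\ continuous h, residual [set x | f x = h x] &
    residual [set s | forall t, T t -> g (s, t) = h (s + t)]].
Proof.
move=> fB T2 gf cF FT; set S := (X in residual X) => S1.
have [E E1 fE] := baire_property_continuous (second_countable_realType R) fB.
have {}fE x e : E x -> 0 < e ->
    \forall y \near x, E y -> `|f x - f y| < e.
  move=> Ex e0; move/subspace_continuousP : fE => /(_ x Ex).
  by move/cvgrPdist_lt; exact.
have [D [cD DT FD]] : exists D, [/\ countable D, D `<=` T &
    forall A, F A -> A `<=` closure (A `&` D)].
  have /choice[d dP] := fun A : set R =>
    countable_dense_subset A (second_countable_realType R).
  exists (\bigcup_(A in F) d A); split.
  - by apply: bigcup_countable => // A _; have [] := dP A.
  - by move=> t [A FA dt]; apply: FT FA _ _; have [_ + _] := dP A; apply.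
  - move=> A FA; have [_ dA Ad] := dP A; apply: subset_trans Ad _.
    by apply: closureS => t dt; split; [exact: dA|exists A].
pose S' := S `&` \bigcap_(t in D)
  ([set s | g (s, t) = f (s + t)] `&` [set s | E (s + t)]).
have S'1 : residual S'.
  apply: residualI => //; apply: residual_bigcap => // t Dt.
  by apply: residualI; [exact/gf/DT|exact: residual_shift].
pose N := \bigcup_(A in F) (A `\` (closure A)°).
have N1 : first_category N.
  apply: first_category_bigcup => // A _.
  exact/nowhere_dense_first_category/nowhere_dense_setDclosure.
(* Otherwise [T] would be covered by [N] and the reflection under [t -> x - t] of the complement of
   [S'], both of first category. *)
have decomp x : exists s t, [/\ S' s, T t, ~ N t & x = s + t].
  apply: contrapT => nst; apply: T2.
  apply: first_categoryS (first_categoryU N1 (first_category_reflect x S'1)).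
  move=> t Tt; have [Nt|nNt] := pselect (N t); [by left|right => S's].
  by apply: nst; exists (x - t), t; split; rewrite ?subrK.
have Edense x : closure E x.
  have [s [t [[Ss S's] Tt _ ->]]] := decomp x.
  have [A [FA At _]] := Ss t Tt 1 ltr01.
  move=> U stU; have [|u [[Au Du] Uu]] := FD A FA t At [set u | U (s + u)].
    exact: nbhs_addl.
  by exists (s + u); split=> //; have [] := S's u Du.
have fcvg (x : R) : cvg (f @ within E (nbhs x)).
  have PF : ProperFilter (within E (nbhs x)) by exact/within_nbhs_proper/Edense.
  (* By completeness it suffices that, for each [e], [f] stays within [e] of some constant on [E]
     near [x]; the constant [g (s, t)] may change with [e]. *)
  apply: cauchy_cvg; apply: cauchy_exP => e e0.
  have e20 : 0 < e / 2 by rewrite divr_gt0.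
  have [s [t [[Ss S's] Tt nNt ->]]] := decomp x.
  have [A [FA At gA]] := Ss t Tt _ e20.
  have tA : (closure A)° t by apply: contrapT => ntA; apply: nNt; exists A.
  exists (g (s, t)).
  change (\forall y \near (s + t), E y -> ball (g (s, t)) e (f y)).
  have : \forall y \near (s + t), (closure A)° (y - s).
    apply: (cvgB cvg_id (cvg_cst s)).
    by rewrite addrC addKr; exact: nbhs_interior.
  apply: filterS => y /interior_subset yA Ey.
  have {}yA : closure (A `&` D) (y - s).
    have /closure_id -> := @closed_closure _ (A `&` D).
    by apply: closureS yA; exact: FD.
  (* Continuity of [f] on [E] at [y] allows [y] to be replaced by a nearby [s + u] with [u] in [D],
     where [f (s + u) = g (s, u)]. *)
  have [|u [[Au Du] Ufy]] := yA [set u | E (s + u) -> `|f y - f (s + u)| < e / 2].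
    apply: (@nbhs_addl _ _ [set z | E z -> `|f y - f z| < e / 2]).
    by rewrite addrC subrK; exact: fE.
  have [/= gfu Esu] := S's u Du.
  rewrite /ball /= (splitr e).
  have -> : g (s, t) - f y = (g (s, t) - g (s, u)) - (f y - f (s + u)).
    by rewrite gfu opprB addrA subrK.
  by rewrite (le_lt_trans (ler_normB _ _))// ltrD// ?gA ?Ufy.
have [h hc hf] := dense_continuous_extension Edense fcvg.
exists h; split=> //.
  by apply: residualS E1 => x Ex /=; rewrite hf.
apply: residualS S'1 => s [Ss S's] t Tt.
apply/eqP; rewrite -subr_eq0 -normr_le0; apply/ler_addgt0Pr => e e0.
have e20 : 0 < e / 2 by rewrite divr_gt0.
have [A [FA At gA]] := Ss t Tt _ e20.
(* The point [t] is itself approximated from [A] and [D], as [h], unlike [f], is continuous at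
   [s + t] even outside [E]. *)
have [|u [[Au Du] hu]] := FD A FA t At [set u | `|h (s + t) - h (s + u)| < e / 2].
  by have /cvgrPdist_lt/(_ _ e20)/nbhs_addl := hc (s + t).
have [/= gfu Esu] := S's u Du.
have -> : g (s, t) - h (s + t) =
    (g (s, t) - g (s, u)) - (h (s + t) - h (s + u)).
  by rewrite gfu (hf _ Esu) opprB addrA subrK.
rewrite add0r ltW// [ltRHS]splitr.
by rewrite (le_lt_trans (ler_normB _ _))// ltrD// gA.
Qed.

End translates.

(* [Topological T] is the type of topological structures on the subtype
   [{t : R | t \in T}] of points of T, so [tau] is unrelated to the usual
   topology of R; [Topological.Pack tau] is that subtype equipped with [tau]. *)
Theorem theorem5 (R : realType) (f : R -> R) (T : set R) (g : R * R -> R) :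
  baire_property f ->
  second_category T ->
  (forall t : R, T t -> residual [set s : R | g (s, t) = f (s + t)]) ->
  (exists tau : Topological T,
      let X := Topological.Pack tau in
      @second_countable X /\
      residual [set s : R | continuous (fun t : X => g (s, \val t))]) ->
  exists h : R -> R,
    [/\ continuous h,
        residual [set x : R | f x = h x] &
        residual [set s : R | forall t : R, T t -> g (s, t) = h (s + t)]].
Proof.
move=> fB T2 gf [tau [[B cB [_ Bnbhs]] gc]].
pose X := Topological.Pack tau.
pose F : set (set R) := [set (fun t : X => \val t) @` b | b in B].
apply: (@continuous_extension_of_sections R f T g F) => //.
- by apply: sub_countable (card_image_le _ _) _.
- by move=> _ [b _ <-] _ [t _ <-]; exact: set_valP.
apply: residualS gc => s gs t Tt e e0.
pose t' : X := SigSub (mem_set Tt).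
(* The basic set [b] lies in the [tau]-neighborhood of [t'] on which the section stays within [e] of
   its value at [t']. *)
have /cvgrPdist_lt/(_ e e0)/Bnbhs[b [Bb bt'] bg] := gs t'.
exists ((fun t : X => \val t) @` b); split; [by exists b|by exists t'|].
by move=> _ [u bu <-]; exact: bg.
Qed.
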